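(* Let $A$ be an associative ring and $M$ a split noetherian finitely generated projective $A$-module. Let $E(M)\subset GL(M)$ be the subgroup generated by the subgroups $U_{\mathcal F}$, where $\mathcal F$ runs through all splittable flags of submodules of $M$. Then the map $$GL(M)=\pi_1 BGL(M)\longrightarrow \pi_1|\operatorname{RBS}(M)|$$ induced by the inclusion of the empty flag is surjective with kernel $E(M)$, so that $$\pi_1|\operatorname{RBS}(M)| = GL(M)/E(M).$$
   Context: A finitely generated projective $A$-module $M$ is split noetherian if every increasing chain of splittable submodules (i.e. direct summands) of $M$ stabilises. A splittable flag in $M$ is a (possibly empty) chain of submodules $\mathcal F=(M_1\subsetneq\dots\subsetneq M_{d-1})$ such that, with $M_0=0$ and $M_d=M$, each $M_i/M_{i-1}$ is nonzero and finitely generated projective. $GL(M)$ denotes the group of $A$-linear automorphisms of $M$; it acts on splittable flags. Write $\mathcal F\le\mathcal F'$ (refinement) when the set of modules occurring in $\mathcal F'$ is a subset of the set of those occurring in $\mathcal F$. $U_{\mathcal F}\subset GL(M)$ is the subgroup of automorphisms which preserve each $M_i$ and induce the identity on each $M_i/M_{i-1}$. The category $\operatorname{RBS}(M)$ has as objects the splittable flags in $M$; the set of morphisms $\mathcal F\to\mathcal F'$ is $\{g\in GL(M): g\mathcal F\le\mathcal F'\}/U_{\mathcal F}$ (quotient by right multiplication), with composition induced by multiplication in $GL(M)$. $|\cdot|$ denotes geometric realisation (the homotopy type obtained by inverting all morphisms). The empty flag has automorphism group $GL(M)$ in $\operatorname{RBS}(M)$; the inclusion of the full subcategory on it gives the map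 $BGL(M)\to|\operatorname{RBS}(M)|$, and the fundamental groups are based at the empty flag. *)

(* Defs.v *)
From HB Require Import structures.
From mathcomp Require Import all_boot all_algebra.
From mathcomp Require Import boolp classical_sets.

Set Implicit Arguments.
Unset Strict Implicit.
Unset Printing Implicit Defensive.

Import GRing.Theory.
Local Open Scope group_scope.
Local Open Scope ring_scope.
Local Open Scope classical_set_scope.
Local Open Scope quotient_scope.

Record equivalence (T : Type) := Equivalence {
  eqv :> T -> T -> Prop;
  eqv_refl : forall x, eqv x x;
  eqv_sym : forall x y, eqv x y -> eqv y x;
  eqv_trans : forall x y z, eqv x y -> eqv y z -> eqv x z }.

Section Quotient.
Context {T : Type} (R : equivalence T).

Definition eqvb : rel {classic T} := fun x y => `[< R x y >].

Let eqvb_refl : reflexive eqvb.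
Proof. by move=> x; apply/asboolP; exact: eqv_refl. Qed.

Let eqvb_sym : symmetric eqvb.
Proof. by move=> x y; apply/asboolP/asboolP; exact: eqv_sym. Qed.

Let eqvb_trans : transitive eqvb.
Proof.
by move=> y x z /asboolP xy /asboolP yz; apply/asboolP; exact: eqv_trans yz.
Qed.

Canonical eqvb_equiv := EquivRel eqvb eqvb_refl eqvb_sym eqvb_trans.

Definition quo := {eq_quot eqvb}.
HB.instance Definition _ := Choice.on quo.

Definition class (x : T) : quo := \pi_{eq_quot eqvb} (x : {classic T}).
Definition lift (x : quo) : T := repr (x : {eq_quot eqvb}).

Lemma liftK x : class (lift x) = x.
Proof. exact: (@reprK _ {eq_quot eqvb}). Qed.

Lemma classE x y : class x = class y <-> R x y.
Proof.
split; last by move=> xy; apply/eqquotP/asboolP.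
by move/eqquotP/asboolP.
Qed.

Lemma lift_class x : R (lift (class x)) x.
Proof. by apply/classE; rewrite liftK. Qed.

Lemma class_ind (P : quo -> Prop) : (forall x, P (class x)) -> forall x, P x.
Proof. by move=> Pc x; rewrite -(liftK x). Qed.

End Quotient.

Lemma morph_gmul1 (G H : groupType) (f : G -> H) :
  {morph f : x y / (x * y)%g} -> f 1%g = 1%g.
Proof. by move=> fM; apply: (mulIg (f 1%g)); rewrite -fM !mul1g. Qed.

Section Groups.
Variable G : groupType.

Definition is_subgroup (H : set G) : Prop :=
  [/\ H 1%g, (forall g h, H g -> H h -> H (g * h)%g)
    & (forall g, H g -> H g^-1%g)].

Definition generated (S : set G) : set G := smallest is_subgroup S.

Definition is_normal (H : set G) : Prop :=
  is_subgroup H /\ forall g h, H h -> H (g * h * g^-1)%g.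

Section QuotientGroup.
Variables (H : set G) (nH : is_normal H).

Definition lcoset_equiv : equivalence G.
Proof.
exists (fun g h => exists2 u, H u & h = (g * u)%g).
- by move=> g; exists 1%g; [case: nH => -[]|rewrite mulg1].
- move=> g h [u Hu ->]; exists u^-1%g; last by rewrite mulgK.
  by case: nH => -[_ _ +] _; apply.
- move=> g h k [u Hu ->] [v Hv ->]; exists (u * v)%g; last by rewrite mulgA.
  by case: nH => -[_ + _] _; apply.
Defined.

Definition quotient_group : Type := quo lcoset_equiv.
HB.instance Definition _ := Choice.on quotient_group.

Definition coset (g : G) : quotient_group := class lcoset_equiv g.

Lemma coset_ind (P : quotient_group -> Prop) :
  (forall g, P (coset g)) -> forall x, P x.
Proof. exact: class_ind. Qed.

Definition coset_mul (x y : quotient_group) : quotient_group :=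
  coset (lift x * lift y)%g.
Definition coset_inv (x : quotient_group) : quotient_group :=
  coset (lift x)^-1%g.

Lemma coset_mulE g h : coset_mul (coset g) (coset h) = coset (g * h)%g.
Proof.
apply/(classE lcoset_equiv).
have [u Hu] := lift_class lcoset_equiv g.
have [v Hv] := lift_class lcoset_equiv h.
rewrite -![class _ _]/(coset _); move: (lift _) (lift _) => a b -> ->.
case: nH => -[_ HM _] HJ.
exists ((b^-1 * u * b^-1^-1) * v)%g; first exact/HM/Hv/HJ.
by rewrite invgK !mulgA mulgK.
Qed.

Lemma coset_invE g : coset_inv (coset g) = coset g^-1%g.
Proof.
apply/(classE lcoset_equiv); have [u Hu] := lift_class lcoset_equiv g.
rewrite -![class _ _]/(coset _); move: (lift _) => a ->.
case: nH => -[_ _ HV] HJ.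
by exists (a * u^-1 * a^-1)%g; [exact/HJ/HV|rewrite invgM !mulgA mulVg mul1g].
Qed.

Let coset_mulA : associative coset_mul.
Proof.
move=> x y z; elim/coset_ind: x => x; elim/coset_ind: y => y.
by elim/coset_ind: z => z; rewrite !coset_mulE mulgA.
Qed.

Let coset_mul1 : left_id (coset 1%g) coset_mul.
Proof. by move=> x; elim/coset_ind: x => x; rewrite coset_mulE mul1g. Qed.

Let coset_mulr1 : right_id (coset 1%g) coset_mul.
Proof. by move=> x; elim/coset_ind: x => x; rewrite coset_mulE mulg1. Qed.

Let coset_mulV : left_inverse (coset 1%g) coset_inv coset_mul.
Proof. by move=> x; elim/coset_ind: x => x; rewrite coset_invE coset_mulE mulVg. Qed.

Let coset_mulrV : right_inverse (coset 1%g) coset_inv coset_mul.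
Proof. by move=> x; elim/coset_ind: x => x; rewrite coset_invE coset_mulE mulgV. Qed.

HB.instance Definition _ := isGroup.Build quotient_group
  coset_mulA coset_mul1 coset_mulr1 coset_mulV coset_mulrV.

End QuotientGroup.
End Groups.

(* [comp g f] is "g after f". *)

Record category := Category {
  obj :> Type;
  hom : obj -> obj -> Type;
  idc : forall x, hom x x;
  comp : forall x y z, hom y z -> hom x y -> hom x z;
  compA : forall x y z t (h : hom z t) (g : hom y z) (f : hom x y),
    comp h (comp g f) = comp (comp h g) f;
  comp1c : forall x y (f : hom x y), comp (idc y) f = f;
  compc1 : forall x y (f : hom x y), comp f (idc x) = f }.
Arguments idc {c} x.
Arguments comp {c x y z} _ _.

Record functor (C D : category) := Functor {
  fobj :> C -> D;
  fhom : forall x y, hom x y -> hom (fobj x) (fobj y);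
  fhom1 : forall x, fhom (idc x) = idc (fobj x);
  fhomM : forall x y z (g : hom y z) (f : hom x y),
    fhom (comp g f) = comp (fhom g) (fhom f) }.

(* The one-object category BG of a group. *)
Definition deloop (G : groupType) : category :=
  @Category unit (fun _ _ => G) (fun _ => 1%g) (fun _ _ _ g h => (g * h)%g)
    (fun _ _ _ _ g h k => mulgA g h k) (fun _ _ g => mul1g g)
    (fun _ _ g => mulg1 g).

(* The localisation C[C^-1] at all morphisms: the groupoid presented by the
   morphisms of C (the edges of the nerve), subject to the relations of C (its
   2-simplices).  As |C| is the homotopy type obtained from C by inverting all
   morphisms, C[C^-1] is its fundamental groupoid, and pi_1(|C|, x) is the
   automorphism group of x in C[C^-1]. *)

Inductive gword (C : category) : C -> C -> Type :=
| gmor x y (f : hom x y) : gword x y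
| gid x : gword x x
| gcomp x y z (q : gword y z) (p : gword x y) : gword x z
| ginv x y (p : gword x y) : gword y x.
Arguments gmor {C x y} f.
Arguments gid {C} x.
Arguments gcomp {C x y z} q p.
Arguments ginv {C x y} p.

Inductive gword_eq (C : category) :
    forall x y : C, gword x y -> gword x y -> Prop :=
| gw_refl x y (p : gword x y) : gword_eq p p
| gw_sym x y (p q : gword x y) : gword_eq p q -> gword_eq q p
| gw_trans x y (p q r : gword x y) :
    gword_eq p q -> gword_eq q r -> gword_eq p r
| gw_congM x y z (q q' : gword y z) (p p' : gword x y) :
    gword_eq q q' -> gword_eq p p' -> gword_eq (gcomp q p) (gcomp q' p')
| gw_congV x y (p p' : gword x y) :
    gword_eq p p' -> gword_eq (ginv p) (ginv p')
| gw_A x y z t (r : gword z t) (q : gword y z) (p : gword x y) :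
    gword_eq (gcomp r (gcomp q p)) (gcomp (gcomp r q) p)
| gw_1l x y (p : gword x y) : gword_eq (gcomp (gid y) p) p
| gw_1r x y (p : gword x y) : gword_eq (gcomp p (gid x)) p
| gw_Vl x y (p : gword x y) : gword_eq (gcomp (ginv p) p) (gid x)
| gw_Vr x y (p : gword x y) : gword_eq (gcomp p (ginv p)) (gid y)
| gw_mor1 x : gword_eq (gmor (idc x)) (gid x)
| gw_morM x y z (g : hom y z) (f : hom x y) :
    gword_eq (gmor (comp g f)) (gcomp (gmor g) (gmor f)).

Section Localisation.
Variable C : category.

Definition gword_equiv (x y : C) : equivalence (gword x y) :=
  Equivalence (@gw_refl C x y) (@gw_sym C x y) (@gw_trans C x y).

Definition loc_hom (x y : C) : Type := quo (gword_equiv x y).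
Definition loc_class (x y : C) (p : gword x y) : loc_hom x y :=
  class (gword_equiv x y) p.
Definition loc_id (x : C) : loc_hom x x := loc_class (gid x).
Definition loc_comp (x y z : C) (q : loc_hom y z) (p : loc_hom x y) :
  loc_hom x z := loc_class (gcomp (lift q) (lift p)).
Definition loc_inv (x y : C) (p : loc_hom x y) : loc_hom y x :=
  loc_class (ginv (lift p)).

Lemma loc_classE x y (p q : gword x y) :
  loc_class p = loc_class q <-> gword_eq p q.
Proof. exact: classE. Qed.

Lemma loc_ind x y (P : loc_hom x y -> Prop) :
  (forall p, P (loc_class p)) -> forall p, P p.
Proof. exact: class_ind. Qed.

Lemma loc_compE x y z (q : gword y z) (p : gword x y) :
  loc_comp (loc_class q) (loc_class p) = loc_class (gcomp q p).
Proof. by apply/loc_classE; apply: gw_congM; exact: (lift_class (gword_equiv _ _)). Qed.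

Lemma loc_invE x y (p : gword x y) :
  loc_inv (loc_class p) = loc_class (ginv p).
Proof. by apply/loc_classE; apply: gw_congV; exact: (lift_class (gword_equiv _ _)). Qed.

Lemma loc_compA x y z t (r : loc_hom z t) (q : loc_hom y z) (p : loc_hom x y) :
  loc_comp r (loc_comp q p) = loc_comp (loc_comp r q) p.
Proof.
elim/loc_ind: r => r; elim/loc_ind: q => q; elim/loc_ind: p => p.
by rewrite !loc_compE; apply/loc_classE/gw_A.
Qed.

Lemma loc_comp1 x y (p : loc_hom x y) : loc_comp (loc_id y) p = p.
Proof. by elim/loc_ind: p => p; rewrite loc_compE; apply/loc_classE/gw_1l. Qed.

Lemma loc_compr1 x y (p : loc_hom x y) : loc_comp p (loc_id x) = p.
Proof. by elim/loc_ind: p => p; rewrite loc_compE; apply/loc_classE/gw_1r. Qed.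

Lemma loc_compV x y (p : loc_hom x y) : loc_comp (loc_inv p) p = loc_id x.
Proof.
by elim/loc_ind: p => p; rewrite loc_invE loc_compE; apply/loc_classE/gw_Vl.
Qed.

Lemma loc_comprV x y (p : loc_hom x y) : loc_comp p (loc_inv p) = loc_id y.
Proof.
by elim/loc_ind: p => p; rewrite loc_invE loc_compE; apply/loc_classE/gw_Vr.
Qed.

Definition localisation : category :=
  @Category C loc_hom loc_id loc_comp loc_compA loc_comp1 loc_compr1.

Definition to_loc : functor C localisation.
Proof.
refine (@Functor C localisation (fun x => x)
  (fun x y f => loc_class (gmor f)) _ _).
- by move=> x; apply/loc_classE/gw_mor1.
- by move=> x y z g f; rewrite /= loc_compE; apply/loc_classE/gw_morM.
Defined.

(* The group law is composition in C[C^-1]: p * q is "p after q". *)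
Definition pi1 (x : C) : Type := @hom localisation x x.

HB.instance Definition _ (x : C) := Choice.on (pi1 x).
HB.instance Definition _ (x : C) := isGroup.Build (pi1 x)
  (@loc_compA x x x x) (@loc_comp1 x x) (@loc_compr1 x x)
  (@loc_compV x x) (@loc_comprV x x).

End Localisation.
Arguments pi1 C x : clear implicits.


Lemma loc_universal (C D : category) (F : functor C D)
    (inv : forall x y : C, hom x y -> hom (fobj F y) (fobj F x)) :
  (forall x y (f : hom x y), comp (inv x y f) (fhom F f) = idc (fobj F x)) ->
  (forall x y (f : hom x y), comp (fhom F f) (inv x y f) = idc (fobj F y)) ->
  exists! H : forall x y : localisation C, hom x y -> hom (fobj F x) (fobj F y),
    [/\ forall x, H x x (idc x) = idc (fobj F x),
        forall x y z (q : hom y z) (p : hom x y),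
          H x z (comp q p) = comp (H y z q) (H x y p)
      & forall (x y : C) (f : hom x y),
          H x y (fhom (to_loc C) f) = fhom F f].
Proof.
move=> invl invr.
pose K := fix K x y (p : gword x y) :
    hom (fobj F x) (fobj F y) * hom (fobj F y) (fobj F x) :=
  match p in gword x y
    return (hom (fobj F x) (fobj F y) * hom (fobj F y) (fobj F x))%type with
  | gmor x y f => (fhom F f, inv x y f)
  | gid x => (idc (fobj F x), idc (fobj F x))
  | gcomp x y z q p => (comp (K _ _ q).1 (K _ _ p).1,
                        comp (K _ _ p).2 (K _ _ q).2)
  | ginv x y p => ((K _ _ p).2, (K _ _ p).1)
  end.
have Kinv x y (p : gword x y) : comp (K _ _ p).2 (K _ _ p).1 = idc _ /\
   comp (K _ _ p).1 (K _ _ p).2 = idc _.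
  elim: p => {x y} [x y f|x|x y z q [q1 q2] p [p1 p2]|x y p []//] /=.
  - by split.
  - by split; rewrite comp1c.
  - split; first by rewrite compA -(compA (K _ _ p).2) q1 compc1 p1.
    by rewrite compA -(compA (K _ _ q).1) p2 compc1 q2.
have inv_uniq (x y : D) (f f' : hom x y) (g g' : hom y x) :
    comp g f = idc x -> comp f' g' = idc y -> f = f' -> g = g'.
  by move=> gf fg ff; rewrite -(compc1 g) -fg compA -ff gf comp1c.
have Keq x y (p q : gword x y) : gword_eq p q -> (K _ _ p).1 = (K _ _ q).1.
  elim=> {x y p q} //=.
  - by move=> x y p q r _ -> _ ->.
  - by move=> x y z q q' p p' _ -> _ ->.
  - move=> x y p q _ e; apply: inv_uniq e; first by case: (Kinv _ _ p).
    by case: (Kinv _ _ q).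
  - by move=> *; rewrite compA.
  - by move=> *; rewrite comp1c.
  - by move=> *; rewrite compc1.
  - by move=> x y p; case: (Kinv _ _ p).
  - by move=> x y p; case: (Kinv _ _ p).
  - by move=> x; rewrite fhom1.
  - by move=> *; rewrite fhomM.
pose H x y (p : loc_hom x y) := (K _ _ (lift p)).1.
have HE x y (p : gword x y) : H _ _ (loc_class p) = (K _ _ p).1.
  exact/Keq/(lift_class (gword_equiv x y)).
exists H; split.
  split=> [x|x y z q p|x y f]; first by rewrite -[LHS]/(H x x (loc_class (@gid C x))) HE.
    move: q p; elim/loc_ind=> q; elim/loc_ind=> p.
    by rewrite [comp _ _]loc_compE !HE.
  by rewrite -[LHS]/(H x y (loc_class (@gmor C x y f))) HE.
move=> H' [H1 HM Hf].
apply: functional_extensionality_dep => x.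
apply: functional_extensionality_dep => y.
apply: functional_extensionality_dep => p.
elim/loc_ind: p => p; rewrite HE.
elim: p => {x y} [x y f|x|x y z q q1 p p1|x y p p1] /=.
- by rewrite -Hf.
- by rewrite -(H1 x).
- by rewrite q1 p1 -HM /= loc_compE.
have [a b] := Kinv _ _ p.
apply: inv_uniq a _ p1.
by rewrite -HM /= -loc_invE loc_comprV (H1 y).
Qed.

Section Pi1Map.
Variables (C D : category) (F : functor C D).

Fixpoint gword_map (x y : C) (p : gword x y) : gword (fobj F x) (fobj F y) :=
  match p in gword x y return gword (fobj F x) (fobj F y) with
  | gmor x y f => gmor (fhom F f)
  | gid x => gid (fobj F x)
  | gcomp x y z q p => gcomp (gword_map q) (gword_map p)
  | ginv x y p => ginv (gword_map p)
  end.

Lemma gword_map_eq x y (p q : gword x y) :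
  gword_eq p q -> gword_eq (gword_map p) (gword_map q).
Proof.
elim=> {x y p q} /=; try by constructor.
- by move=> x y p q r _ pq _ qr; exact: gw_trans pq qr.
- by move=> x; rewrite fhom1; constructor.
- by move=> x y z g f; rewrite fhomM; constructor.
Qed.

(* Induced by |F| : |C| -> |D|. *)
Definition pi1_map (x : C) (p : pi1 C x) : pi1 D (fobj F x) :=
  loc_class (gword_map (lift p)).

Lemma pi1_mapE x (p : gword x x) :
  pi1_map (loc_class p) = loc_class (gword_map p).
Proof.
by apply/loc_classE/gword_map_eq; exact: (lift_class (gword_equiv x x)).
Qed.

Lemma pi1_mapM x : {morph @pi1_map x : p q / (p * q)%g}.
Proof.
move=> p q; elim/loc_ind: p => p; elim/loc_ind: q => q.
by rewrite [(_ * _)%g]loc_compE !pi1_mapE [RHS]loc_compE.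
Qed.

HB.instance Definition _ x :=
  isMultiplicative.Build (pi1 C x) (pi1 D (fobj F x)) (@pi1_map x)
    (@pi1_mapM x).
HB.instance Definition _ x :=
  Multiplicative_isUMagmaMorphism.Build (pi1 C x) (pi1 D (fobj F x))
    (@pi1_map x) (morph_gmul1 (@pi1_mapM x)).

End Pi1Map.

Section Pi1Deloop.
Variable G : groupType.

Definition to_pi1B (g : G) : pi1 (deloop G) tt :=
  loc_class (@gmor (deloop G) tt tt g).

Lemma to_pi1BM : {morph to_pi1B : g h / (g * h)%g}.
Proof.
move=> g h; rewrite [RHS]loc_compE.
exact/loc_classE/(@gw_morM (deloop G) tt tt tt).
Qed.

HB.instance Definition _ :=
  isMultiplicative.Build G (pi1 (deloop G) tt) to_pi1B to_pi1BM.
HB.instance Definition _ :=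
  Multiplicative_isUMagmaMorphism.Build G (pi1 (deloop G) tt) to_pi1B
    (morph_gmul1 to_pi1BM).

(* This is the identification G = pi_1 BG. *)
Lemma to_pi1B_bij : bijective to_pi1B.
Proof.
have [H [[H1 HM Hf] _]] := @loc_universal (deloop G) (deloop G)
  (@Functor (deloop G) (deloop G) id (fun _ _ => id)
     (fun=> erefl) (fun _ _ _ _ _ => erefl)) (fun _ _ (g : G) => g^-1%g)
  (fun _ _ => @mulVg G) (fun _ _ => @mulgV G).
exists (H tt tt) => [g|]; first exact: (Hf tt tt g).
have surj x y (p : @gword (deloop G) x y) :
    exists g : G, loc_class p = loc_class (@gmor (deloop G) x y g).
  elim: p => {x y} [x y g|x|x y z q [h qh] p [g pg]|x y p [g pg]].
  - by exists g.
  - by exists 1%g; apply/loc_classE/gw_sym/(@gw_mor1 (deloop G)).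
  - exists (h * g)%g; rewrite -loc_compE qh pg loc_compE.
    exact/loc_classE/gw_sym/(@gw_morM (deloop G)).
  exists g^-1%g; rewrite -loc_invE pg -[LHS]loc_compr1.
  have -> : loc_id y = loc_class (gcomp (@gmor (deloop G) x y g)
                                        (@gmor (deloop G) y x g^-1%g)).
    apply/loc_classE/gw_sym; apply: gw_trans (@gw_mor1 (deloop G) y).
    rewrite -[idc _]/(1%g : G) -(mulgV g).
    exact/gw_sym/(@gw_morM (deloop G) y x y).
  by rewrite -loc_compE loc_compA loc_compV loc_comp1.
elim/loc_ind=> p; have [g ->] := surj _ _ p.
by congr to_pi1B; exact: (Hf tt tt g).
Qed.

End Pi1Deloop.

Section Submodules.
Variables (A : pzRingType) (M : lmodType A).

Record submodule := Submodule {
  submodule_pred :> {pred M};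
  submoduleP : submod_closed submodule_pred }.

Lemma submodule_eq (S T : submodule) : S =i T -> S = T.
Proof.
case: S T => [S hS] [T hT] ST.
have {}ST : S = T by apply: funext; exact: ST.
by case: T / ST hT => hT; congr Submodule; exact: Prop_irrelevance.
Qed.

HB.instance Definition _ := gen_eqMixin submodule.
HB.instance Definition _ := gen_choiceMixin submodule.

HB.instance Definition _ (S : submodule) :=
  GRing.isSubmodClosed.Build A M (submodule_pred S) (submoduleP S).

Definition submod0 : submodule.
Proof.
exists (pred1 0); split=> [|a u v]; rewrite !inE //.
by move=> /eqP-> /eqP->; rewrite scaler0 addr0.
Defined.

Definition submodT : submodule.
Proof. by exists predT; split. Defined.

Definition sub_module (S : submodule) : Type := {x : M | x \in S}.
HB.instance Definition _ S := SubChoice.on (sub_module S).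
HB.instance Definition _ S := [SubChoice_isSubLmodule of sub_module S by <:].

End Submodules.

Section QuotientModule.
Variables (A : pzRingType) (M : lmodType A) (S : submodule M).

Definition submod_equiv : equivalence M.
Proof.
exists (fun x y => x - y \in S).
- by move=> x; rewrite subrr rpred0.
- by move=> x y xy; rewrite -opprB rpredN.
- by move=> x y z xy yz; rewrite -(subrKA y) rpredD.
Defined.

Definition quot_module : Type := quo submod_equiv.
HB.instance Definition _ := Choice.on quot_module.

Definition quot_class (x : M) : quot_module := class submod_equiv x.

Lemma quot_classE x y : quot_class x = quot_class y <-> x - y \in S.
Proof. exact: classE. Qed.

Lemma quot_ind (P : quot_module -> Prop) :
  (forall x, P (quot_class x)) -> forall x, P x.
Proof. exact: class_ind. Qed.

Lemma quot_lift x : lift (quot_class x) - x \in S.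
Proof. exact: (lift_class submod_equiv). Qed.

Definition quot_add (x y : quot_module) := quot_class (lift x + lift y).
Definition quot_opp (x : quot_module) := quot_class (- lift x).
Definition quot_scale (a : A) (x : quot_module) := quot_class (a *: lift x).

Lemma quot_addE x y :
  quot_add (quot_class x) (quot_class y) = quot_class (x + y).
Proof.
by apply/quot_classE; rewrite opprD addrACA rpredD // quot_lift.
Qed.

Lemma quot_oppE x : quot_opp (quot_class x) = quot_class (- x).
Proof. by apply/quot_classE; rewrite -opprD rpredN quot_lift. Qed.

Lemma quot_scaleE a x : quot_scale a (quot_class x) = quot_class (a *: x).
Proof. by apply/quot_classE; rewrite -scalerBr rpredZ // quot_lift. Qed.

Let quot_addA : associative quot_add.
Proof.
move=> x y z; elim/quot_ind: x => x; elim/quot_ind: y => y.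
by elim/quot_ind: z => z; rewrite !quot_addE addrA.
Qed.

Let quot_addC : commutative quot_add.
Proof.
move=> x y; elim/quot_ind: x => x; elim/quot_ind: y => y.
by rewrite !quot_addE addrC.
Qed.

Let quot_add0 : left_id (quot_class 0) quot_add.
Proof. by move=> x; elim/quot_ind: x => x; rewrite quot_addE add0r. Qed.

Let quot_addN : left_inverse (quot_class 0) quot_opp quot_add.
Proof.
by move=> x; elim/quot_ind: x => x; rewrite quot_oppE quot_addE addNr.
Qed.

HB.instance Definition _ := GRing.isZmodule.Build quot_module
  quot_addA quot_addC quot_add0 quot_addN.

Let quot_scaleA a b x : quot_scale a (quot_scale b x) = quot_scale (a * b) x.
Proof. by elim/quot_ind: x => x; rewrite !quot_scaleE scalerA. Qed.

Let quot_scale1 : left_id 1 quot_scale.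
Proof. by move=> x; elim/quot_ind: x => x; rewrite quot_scaleE scale1r. Qed.

Let quot_scaleDr : right_distributive quot_scale +%R.
Proof.
move=> a x y; elim/quot_ind: x => x; elim/quot_ind: y => y.
by rewrite -[quot_class x + _]/(quot_add _ _) quot_addE !quot_scaleE
  [RHS]quot_addE scalerDr.
Qed.

Let quot_scaleDl x : {morph quot_scale^~ x : a b / a + b}.
Proof.
move=> a b; elim/quot_ind: x => x.
by rewrite !quot_scaleE [RHS]quot_addE scalerDl.
Qed.

HB.instance Definition _ := GRing.Zmodule_isLmodule.Build A quot_module
  quot_scaleA quot_scale1 quot_scaleDr quot_scaleDl.

End QuotientModule.

Section Projective.
Variable A : pzRingType.

Definition finitely_generated (P : lmodType A) : Prop :=
  exists s : seq P, forall x : P,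
    exists c : 'I_(size s) -> A, x = \sum_(i < size s) c i *: s`_i.

Definition projective (P : lmodType A) : Prop :=
  forall (U V : lmodType A) (f : {linear U -> V}) (g : {linear P -> V}),
    (forall v, exists u, f u = v) ->
    exists h : {linear P -> U}, forall x, f (h x) = g x.

Definition fg_projective (P : lmodType A) : Prop :=
  finitely_generated P /\ projective P.

Variable M : lmodType A.

(* The quotient T / S, meaningful when S is contained in T. *)
Definition trace (S T : submodule M) : submodule (sub_module T).
Proof.
exists (fun x : sub_module T => val x \in S).
case: (submoduleP S) => S0 SD.
by split=> [|a u v uS vS]; [exact: S0|exact: SD].
Defined.

Definition subquotient (S T : submodule M) : lmodType A :=
  quot_module (trace S T).

Definition splittable (S : submodule M) : Prop :=
  exists T : submodule M,
    (forall x, x \in S -> x \in T -> x = 0) /\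
    (forall x, exists u v, [/\ u \in S, v \in T & x = u + v]).

Definition split_noetherian : Prop :=
  forall S : nat -> submodule M,
    (forall i, splittable (S i)) ->
    (forall i, {subset S i <= S i.+1}) ->
    exists n, forall m, (n <= m)%N -> S m = S n.

End Projective.

Section GL.
Variables (A : pzRingType) (M : lmodType A).

Record GL := MkGL {
  gl_fun :> {linear M -> M};
  gl_inv : M -> M;
  gl_funK : cancel gl_fun gl_inv;
  gl_invK : cancel gl_inv gl_fun }.

Lemma linear_eq (f g : {linear M -> M}) : f =1 g -> f = g.
Proof.
case: f g => [f [[f1] [f2]]] [g [[g1] [g2]]] /= fg.
have {}fg : f = g by apply: funext; exact: fg.
case: g / fg g1 g2 => g1 g2.
by rewrite (Prop_irrelevance f1 g1) (Prop_irrelevance f2 g2).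
Qed.

Lemma GL_eq (f g : GL) : f =1 g -> f = g.
Proof.
case: f g => [f f' fK f'K] [g g' gK g'K] /= fg.
have {}fg : f = g by exact: linear_eq.
case: g / fg gK g'K => gK g'K.
have fg' : f' = g' by apply: funext => x; rewrite -{1}(g'K x) fK.
case: g' / fg' gK g'K => gK g'K.
by congr MkGL; exact: Prop_irrelevance.
Qed.

HB.instance Definition _ := gen_eqMixin GL.
HB.instance Definition _ := gen_choiceMixin GL.

Lemma gl_inv_linear (g : GL) : linear (gl_inv g).
Proof.
by move=> a x y; apply: (can_inj (gl_funK g)); rewrite linearP !gl_invK.
Qed.

HB.instance Definition _ (g : GL) :=
  GRing.isLinear.Build A M M *:%R (gl_inv g) (gl_inv_linear g).

Definition GL1 : GL := @MkGL idfun id (fun=> erefl) (fun=> erefl).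
Definition GLM (g h : GL) : GL :=
  @MkGL (gl_fun g \o gl_fun h) (gl_inv h \o gl_inv g)
    (can_comp (gl_funK g) (gl_funK h)) (can_comp (gl_invK h) (gl_invK g)).
Definition GLV (g : GL) : GL :=
  @MkGL (gl_inv g) (gl_fun g) (gl_invK g) (gl_funK g).

Let GLMA : associative GLM. Proof. by move=> f g h; exact: GL_eq. Qed.
Let GL1M : left_id GL1 GLM. Proof. by move=> f; exact: GL_eq. Qed.
Let GLM1 : right_id GL1 GLM. Proof. by move=> f; exact: GL_eq. Qed.
Let GLVM : left_inverse GL1 GLV GLM.
Proof. by move=> f; apply: GL_eq; exact: gl_funK. Qed.
Let GLMV : right_inverse GL1 GLV GLM.
Proof. by move=> f; apply: GL_eq; exact: gl_invK. Qed.

HB.instance Definition _ := isGroup.Build GL GLMA GL1M GLM1 GLVM GLMV.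

(* The image g(S), as the preimage of S under the inverse of g. *)
Definition act (g : GL) (S : submodule M) : submodule M.
Proof.
exists [pred x | gl_inv g x \in S]; split=> [|a u v].
  by rewrite inE linear0 rpred0.
by rewrite !inE => uS vS; rewrite linearP rpredD ?rpredZ.
Defined.

Lemma actE g S x : (x \in act g S) = (gl_inv g x \in S).
Proof. by []. Qed.

Lemma mem_act (g : GL) S x : (g x \in act g S) = (x \in S).
Proof. by rewrite actE gl_funK. Qed.

Lemma act1 S : act 1%g S = S.
Proof. exact: submodule_eq. Qed.

Lemma actM g h S : act (g * h)%g S = act g (act h S).
Proof. exact: submodule_eq. Qed.

Lemma actT g : act g (submodT M) = submodT M.
Proof. exact: submodule_eq. Qed.

Lemma act0 g : act g (submod0 M) = submod0 M.
Proof.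
apply: submodule_eq => x; rewrite actE !inE.
by rewrite -(inj_eq (can_inj (gl_funK g))) gl_invK linear0.
Qed.

End GL.

Section Flags.
Variables (A : pzRingType) (M : lmodType A).
Implicit Types (s t : seq (submodule M)) (g u : GL M).

(* For s = (M_1, ..., M_{d-1}): M_0 = 0, M_i for 0 < i < d = (size s).+1, and
   M_i = M for i >= d. *)
Definition stage s (i : nat) : submodule M :=
  nth (submodT M) (submod0 M :: s) i.

(* The nonzero subquotients make the inclusions strict.  The empty chain is
   admitted separately only for the sake of M = 0, where M / 0 is zero. *)
Definition is_flag s : Prop :=
  s = [::] \/
  forall i, (i <= size s)%N ->
    [/\ {subset stage s i <= stage s i.+1},
        (exists x : subquotient (stage s i) (stage s i.+1), x != 0)
      & fg_projective (subquotient (stage s i) (stage s i.+1))].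

Record flag := Flag { flag_seq :> seq (submodule M); flagP : is_flag flag_seq }.

Definition empty_flag : flag := @Flag [::] (or_introl erefl).

(* F <= F' is [refines F F']: the modules of F' all occur in F. *)
Definition refines s t : Prop := {subset t <= s}.

Definition act_chain g s : seq (submodule M) := map (act g) s.

(* U_F: [u] preserves each M_i and is the identity on each M_(i+1) / M_i. *)
Definition unipotent s : set (GL M) :=
  [set u | forall i, (i <= size s)%N ->
     act u (stage s i) = stage s i /\
     forall x, x \in stage s i.+1 -> u x - x \in stage s i].

Definition E_group : set (GL M) :=
  generated (\bigcup_(F in [set: flag]) unipotent F).

Lemma stage_last s i : (size s < i)%N -> stage s i = submodT M.
Proof. by case: i => // i si; rewrite /stage /= nth_default. Qed.

Lemma stage_mem s i : (0 < i <= size s)%N -> stage s i \in s.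
Proof. by case: i => // i /= si; rewrite /stage /= mem_nth. Qed.

Lemma stage_act g s i : stage (act_chain g s) i = act g (stage s i).
Proof.
case: i => [|i]; first by rewrite /stage /= act0.
rewrite /stage /=; have [si|si] := ltnP i (size s).
  by rewrite (nth_map (submodT M)).
by rewrite !nth_default ?size_map ?actT.
Qed.

Lemma unipotent_sub s : is_subgroup (unipotent s).
Proof.
split=> [i si|g h Ug Uh i si|g Ug i si].
- split=> [|x _]; first exact: act1.
  by rewrite subrr rpred0.
- have [g1 g2] := Ug i si; have [h1 h2] := Uh i si.
  split=> [|x xs]; first by rewrite actM h1 g1.
  rewrite -[_ x]/(g (h x)) -(subrKA (g x)) -linearB rpredD ?g2 //.
  by rewrite -g1 mem_act h2.
have [g1 g2] := Ug i si.
have gV j : (j <= size s)%N -> act g^-1%g (stage s j) = stage s j.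
  by move=> sj; have [e _] := Ug j sj; rewrite -{1}e -actM mulVg act1.
split=> [|x xs]; first exact: gV.
have ys : g^-1%g x \in stage s i.+1.
  have [si1|si1] := ltnP i (size s); last by rewrite stage_last.
  by rewrite -(gV i.+1) // mem_act.
by rewrite -opprB rpredN -{1}(gl_invK g x) g2.
Qed.

Lemma unipotentJ g u s :
  unipotent s u -> unipotent (act_chain g s) (g * u * g^-1)%g.
Proof.
move=> Uu i; rewrite size_map => si; have [u1 u2] := Uu i si.
rewrite !stage_act; split=> [|x].
  by rewrite -actM mulgVK actM u1.
rewrite actE => xs.
by rewrite -{2}(gl_invK g x) -[_ x]/(g (u (gl_inv g x))) -linearB mem_act u2.
Qed.

Definition ascending s : Prop :=
  forall i j, (i <= j)%N -> {subset stage s i <= stage s j}.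

Lemma flag_ascending (F : flag) : ascending F.
Proof.
case: F => s sF /=; case: (sF) => [-> {sF}|sP] i j ij /=.
  case: i ij => [_ x|i]; first by rewrite inE => /eqP->; exact: rpred0.
  by case: j => // j _ x; rewrite /stage /= !nth_nil.
have step k : {subset stage s k <= stage s k.+1}.
  have [ks|ks] := leqP k (size s); first by case: (sP k ks).
  by move=> x _; rewrite stage_last // ltnS ltnW.
elim: j ij => [|j IH]; first by rewrite leqn0 => /eqP->.
rewrite leq_eqVlt => /predU1P[-> //|ij] x xi.
exact/step/IH.
Qed.

Lemma ascending_act g s : ascending s -> ascending (act_chain g s).
Proof.
by move=> sP i j ij x; rewrite !stage_act !actE; exact: sP.
Qed.

Lemma unipotent_refine s t :
  ascending s -> refines s t -> unipotent t `<=` unipotent s.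
Proof.
move=> sA st u Uu.
have key v i x : unipotent t v -> x \in stage s i.+1 ->
    v x - x \in stage s i.
  move=> Uv xs.
  pose P j := (j <= size t)%N && `[< {subset stage t j <= stage s i} >].
  have P0 : exists j, P j.
    exists 0%N; apply/andP; split=> //; apply/asboolP => y.
    by rewrite inE => /eqP->; exact: rpred0.
  have Pt j : P j -> (j <= size t)%N by case/andP.
  case: (ex_maxnP P0 Pt) => j /andP[jt /asboolP ji] jmax.
  apply: ji; have [_ +] := Uv j jt; apply.
  have [jt1|jt1] := ltnP j (size t); last by rewrite stage_last.
  have /st/(nthP (submodT M))[k ks kE] : stage t j.+1 \in t.
    exact: stage_mem.
  have {}kE : stage s k.+1 = stage t j.+1 by [].
  have [ki|ik] := leqP k.+1 i; last by rewrite -kE; exact: sA xs.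
  suff /jmax : P j.+1 by rewrite ltnn.
  by rewrite /P jt1 -kE; apply/asboolP; exact: sA.
have stab v i : unipotent t v -> {homo v : x / x \in stage s i}.
  move=> Uv; case: i => [|i] x xs.
    by move: xs; rewrite !inE => /eqP->; rewrite linear0.
  rewrite -(subrK x (v x)) rpredD //.
  by apply: (sA i i.+1 (leqnSn i)); exact: key.
have UV : unipotent t u^-1%g by case: (unipotent_sub t) => _ _; apply.
move=> i si; split=> [|x]; last exact: key.
apply: submodule_eq => x; rewrite actE; apply/idP/idP => xs.
  by rewrite -(gl_invK u x); exact: stab xs.
exact: (stab u^-1%g) xs.
Qed.

Section Hom.
Variables F F' : flag.

(* Morphisms F -> F': {g | g F <= F'} modulo right multiplication by U_F. *)
Definition rbs_pre : Type := {g : GL M | refines (act_chain g F) F'}.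

Definition rbs_equiv : equivalence rbs_pre.
Proof.
exists (fun p q => exists2 u, unipotent F u & sval q = (sval p * u)%g).
- by move=> p; exists 1%g; [case: (unipotent_sub F)|rewrite mulg1].
- move=> p q [u Uu ->]; exists u^-1%g; last by rewrite mulgK.
  by case: (unipotent_sub F) => _ _; apply.
- move=> p q r [u Uu ->] [v Uv ->]; exists (u * v)%g; last by rewrite mulgA.
  by case: (unipotent_sub F) => _ UM _; apply: UM.
Defined.

Definition rbs_hom : Type := quo rbs_equiv.
Definition rbs_class (g : rbs_pre) : rbs_hom := class rbs_equiv g.

Lemma rbs_classE (g h : rbs_pre) : rbs_class g = rbs_class h <->
  exists2 u, unipotent F u & sval h = (sval g * u)%g.
Proof. exact: classE. Qed.

Lemma rbs_ind (P : rbs_hom -> Prop) :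
  (forall p : rbs_pre, P (rbs_class p)) -> forall x, P x.
Proof. exact: class_ind. Qed.

End Hom.

Lemma rbs_pre1_subproof (F : flag) : refines (act_chain 1%g F) F.
Proof.
by move=> S SF; apply/mapP; exists S => //; rewrite act1.
Qed.

Lemma rbs_preM_subproof (F F' F'' : flag) g h :
  refines (act_chain h F') F'' -> refines (act_chain g F) F' ->
  refines (act_chain (h * g)%g F) F''.
Proof.
move=> hF gF S /hF/mapP[T /gF/mapP[W WF ->] ->].
by apply/mapP; exists W => //; rewrite actM.
Qed.

Definition rbs_pre1 (F : flag) : rbs_pre F F :=
  exist _ 1%g (@rbs_pre1_subproof F).

Definition rbs_preM (F F' F'' : flag) (h : rbs_pre F' F'') (g : rbs_pre F F') :
  rbs_pre F F'' :=
  exist _ (sval h * sval g)%g (rbs_preM_subproof (svalP h) (svalP g)).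

Definition rbs_comp (F F' F'' : flag) (h : rbs_hom F' F'') (g : rbs_hom F F') :
  rbs_hom F F'' := rbs_class (rbs_preM (lift h) (lift g)).

Lemma rbs_compE F F' F'' (h : rbs_pre F' F'') (g : rbs_pre F F') :
  rbs_comp (rbs_class h) (rbs_class g) = rbs_class (rbs_preM h g).
Proof.
apply/rbs_classE; rewrite /rbs_comp.
have [u Uu] := lift_class (rbs_equiv F' F'') h.
have [v Uv] := lift_class (rbs_equiv F F') g.
rewrite -![class _ _]/(rbs_class _) /=.
move: (lift _) (lift _) => [b /= bF] [a /= aF] gE hE.
have [_ UM _] := unipotent_sub F.
exists ((a^-1 * u * a) * v)%g; last by rewrite gE hE !mulgA mulgK.
apply: UM => //.
have := unipotentJ (g := a^-1%g) Uu; rewrite invgK.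
apply: unipotent_refine; first exact: flag_ascending.
move=> S /mapP[T /aF/mapP[W WF ->] ->].
by rewrite -actM mulVg act1.
Qed.

Definition RBS : category.
Proof.
refine (@Category flag rbs_hom (fun F => rbs_class (rbs_pre1 F)) rbs_comp
  _ _ _).
- move=> F F' F'' F3 h g f.
  elim/rbs_ind: h => h; elim/rbs_ind: g => g; elim/rbs_ind: f => f.
  rewrite !rbs_compE; apply/rbs_classE; exists 1%g.
    by case: (unipotent_sub F).
  by rewrite /= mulg1 mulgA.
- move=> F F' f; elim/rbs_ind: f => f.
  rewrite !rbs_compE; apply/rbs_classE; exists 1%g.
    by case: (unipotent_sub F).
  by rewrite /= mul1g mulg1.
- move=> F F' f; elim/rbs_ind: f => f.
  rewrite !rbs_compE; apply/rbs_classE; exists 1%g.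
    by case: (unipotent_sub F).
  by rewrite /= !mulg1.
Defined.

Lemma refines_empty (g : GL M) : refines (act_chain g empty_flag) empty_flag.
Proof. by []. Qed.

Definition rbs_empty (g : GL M) : rbs_hom empty_flag empty_flag :=
  rbs_class (exist _ g (refines_empty g)).

(* BGL(M) is the full subcategory of RBS(M) on the empty flag. *)
Lemma rbs_empty_bij : bijective rbs_empty.
Proof.
exists (fun x => sval (lift x)) => [g|x].
  have [u /(_ 0%N isT)[_ u1]] :=
    lift_class (rbs_equiv empty_flag empty_flag) (exist _ g (refines_empty g)).
  rewrite -[class _ _]/(rbs_empty g) /= => gE.
  suff u1' : u = 1%g by rewrite u1' mulg1 in gE.
  apply: GL_eq => x; have /u1 : x \in stage [::] 1 by [].
  by rewrite inE subr_eq0 => /eqP.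
elim/rbs_ind: x => p; apply/rbs_classE.
exact: (lift_class (rbs_equiv empty_flag empty_flag)).
Qed.

Definition incl_empty : functor (deloop (GL M)) RBS.
Proof.
refine (@Functor (deloop (GL M)) RBS (fun=> empty_flag)
  (fun _ _ => rbs_empty) _ _).
- move=> x; apply/(rbs_classE (F := empty_flag)); exists 1%g; last by rewrite mulg1.
  by case: (unipotent_sub [::]).
- move=> x y z g h; rewrite [RHS]rbs_compE.
  apply/(rbs_classE (F := empty_flag)); exists 1%g.
    by case: (unipotent_sub [::]).
  by rewrite mulg1.
Defined.

(* The composite GL(M) = pi_1 BGL(M) -> pi_1 |RBS(M)|. *)
Definition GL_to_pi1 : GL M -> pi1 RBS empty_flag :=
  @pi1_map _ _ incl_empty tt \o @to_pi1B (GL M).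

Lemma GL_to_pi1M : {morph GL_to_pi1 : g h / (g * h)%g}.
Proof. by move=> g h; rewrite /GL_to_pi1 /= to_pi1BM pi1_mapM. Qed.

HB.instance Definition _ :=
  isMultiplicative.Build (GL M) (pi1 RBS empty_flag) GL_to_pi1 GL_to_pi1M.
HB.instance Definition _ :=
  Multiplicative_isUMagmaMorphism.Build (GL M) (pi1 RBS empty_flag) GL_to_pi1
    (morph_gmul1 GL_to_pi1M).

End Flags.
Arguments empty_flag {A} M.
Arguments E_group {A} M.
Arguments RBS {A} M.
Arguments GL_to_pi1 {A} M _.

(* Main.v *)
(** A flag [F] maps to the empty flag by the class [eps F] of the identity, and
    every morphism [g : F -> F'] satisfies [eps F' \o g = g \o eps F], where the
    second [g] is an automorphism of the empty flag.  Hence in the fundamental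
    groupoid every path from [F] to [F'] is of the form
    [(eps F')^-1 \o g \o eps F], which gives surjectivity; and [u] in [U_F]
    satisfies [u \o eps F = eps F], so that [u] becomes trivial.  Conversely
    [g |-> g E(M)] is constant on the classes modulo [U_F], so it is a functor
    from RBS(M) to the group GL(M) / E(M), and it factors through the fundamental
    groupoid. *)

Require Import Defs.
From mathcomp Require Import all_boot all_algebra.
From HB Require Import structures.
From mathcomp Require Import boolp classical_sets.

Set Implicit Arguments.
Unset Strict Implicit.
Unset Printing Implicit Defensive.

Import GRing.Theory.
Local Open Scope group_scope.

(** * Generated subgroups, cosets and the first isomorphism theorem *)

Section GroupFacts.
Variable G : groupType.
Implicit Types N S : set G.

Lemma generated_subgroup S : is_subgroup (generated S).
Proof.
split=> [K [[K1 _ _] _] //|g h Sg Sh K KP|g Sg K KP].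
  by case: (KP) => -[_ KM _] _; apply: KM; [exact: Sg|exact: Sh].
by case: (KP) => -[_ _ KV] _; apply: KV; exact: Sg.
Qed.

Lemma sub_generated S : (S `<=` generated S)%classic.
Proof. by move=> g Sg K [_]; apply. Qed.

(** For a subgroup [K] containing [S], the preimage of [K] under conjugation by [g] is again a
    subgroup containing [S], hence it contains [h]. *)
Lemma generated_normal S :
  (forall g h, S h -> S (g * h * g^-1)) -> is_normal (generated S).
Proof.
move=> SJ; split=> [|g h Sh K [[K1 KM KV] SK]]; first exact: generated_subgroup.
apply: (Sh (fun k => K (g * k * g^-1))); split; last by move=> k /(SJ g)/SK.
split=> [|k l Kk Kl|k Kk]; first by rewrite mulg1 mulgV.
  by have := KM _ _ Kk Kl; rewrite !mulgA mulgVK.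
by have := KV _ Kk; rewrite !invgM invgK mulgA.
Qed.

Lemma cosetE N (nN : is_normal N) g h : coset nN g = coset nN h <-> N (g^-1 * h).
Proof.
split=> [/(classE (lcoset_equiv nN))[u Nu ->]|Ngh]; first by rewrite mulKg.
by apply/(classE (lcoset_equiv nN)); exists (g^-1 * h); rewrite ?mulVKg.
Qed.

End GroupFacts.

Section FirstIsomorphism.
Variables (G H : groupType) (f : G -> H) (N : set G) (nN : is_normal N).
Hypothesis fM : {morph f : g h / g * h}.
Hypothesis ker_f : forall g, f g = 1 <-> N g.

Definition quotient_lift (x : quotient_group nN) : H := f (Defs.lift x).

Lemma morph_eq_coset g h : f g = f h <-> coset nN g = coset nN h.
Proof.
rewrite cosetE -ker_f fM; split=> [<-|fgh].
  by rewrite -fM mulVg (morph_gmul1 fM).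
by rewrite -[LHS]mulg1 -fgh mulgA -fM mulgV (morph_gmul1 fM) mul1g.
Qed.

Lemma quotient_liftE g : quotient_lift (coset nN g) = f g.
Proof. by apply/(morph_eq_coset _ g); exact: Defs.liftK. Qed.

Lemma quotient_liftM : {morph quotient_lift : x y / x * y}.
Proof.
move=> x y; elim/coset_ind: x => g; elim/coset_ind: y => h.
by rewrite [_ * _]coset_mulE !quotient_liftE fM.
Qed.

HB.instance Definition _ :=
  isMultiplicative.Build (quotient_group nN) H quotient_lift quotient_liftM.

Lemma first_isomorphism : (forall x, exists g, f g = x) ->
  exists phi : {multiplicative quotient_group nN -> H},
    bijective phi /\ forall g, phi (coset nN g) = f g.
Proof.
move=> /choice[s sP]; exists quotient_lift; split; last exact: quotient_liftE.
(* The inverse sends [x] to the coset of a chosen preimage [s x]. *)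
exists (fun x => coset nN (s x)) => x /=; last by rewrite quotient_liftE.
by elim/coset_ind: x => g; apply/morph_eq_coset; rewrite sP quotient_liftE.
Qed.

End FirstIsomorphism.

(** * Retracts of modules and maps between subquotients *)

Lemma fg_projective_retract (A : pzRingType) (P Q : lmodType A)
    (r : {linear P -> Q}) (i : {linear Q -> P}) :
  cancel i r -> fg_projective P -> fg_projective Q.
Proof.
move=> iK [[s sP] projP]; split=> [|U V f g fsurj].
  exists (map r s) => x; rewrite size_map.
  have [c ic] := sP (i x); exists c; rewrite -[LHS]iK ic linear_sum.
  by apply: eq_bigr => k _; rewrite linearZ (nth_map 0%R).
(* A lift [h] of [g \o r] restricts along [i] to a lift of [g], since [r \o i] is the identity. *)
have [h hP] := projP U V f (g \o r : {linear P -> V})%FUN fsurj.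
by exists (h \o i : {linear Q -> U})%FUN => x; rewrite /= hP /= iK.
Qed.

Lemma quot_class_linear (A : pzRingType) (M : lmodType A) (S : submodule M) :
  linear (quot_class S).
Proof. by move=> a x y; rewrite -quot_addE -quot_scaleE. Qed.

Section SubquotientMap.
Variables (A : pzRingType) (M : lmodType A) (f : {linear M -> M}).
Variables S T S' T' : submodule M.
Hypothesis fS : {homo f : x / x \in S >-> x \in S'}.
Hypothesis fT : {homo f : x / x \in T >-> x \in T'}.

Definition sub_module_map (x : sub_module T) : sub_module T' :=
  exist _ (f (val x)) (fT (valP x)).

Definition subquotient_fun (x : subquotient S T) : subquotient S' T' :=
  quot_class (trace S' T') (sub_module_map (Defs.lift x)).

Lemma subquotient_funE x :
  subquotient_fun (quot_class (trace S T) x) =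
  quot_class (trace S' T') (sub_module_map x).
Proof.
apply/quot_classE; set y := Defs.lift _.
have /fS : val (y - x)%R \in S by exact: (quot_lift (trace S T)).
by rewrite !raddfB.
Qed.

Lemma subquotient_fun_linear : linear subquotient_fun.
Proof.
move=> a x y; elim/quot_ind: x => x; elim/quot_ind: y => y.
rewrite -quot_class_linear !subquotient_funE -quot_class_linear.
congr quot_class; apply: val_inj => /=.
by rewrite linearP.
Qed.

HB.instance Definition _ :=
  GRing.isLinear.Build A (subquotient S T) (subquotient S' T') *:%R
    subquotient_fun subquotient_fun_linear.

(* [subquotient_fun] does not depend on [fS], so its linear structure cannot be
   inferred outside this section. *)
Definition subquotient_map : {linear subquotient S T -> subquotient S' T'} :=
  subquotient_fun.

Lemma subquotient_mapE x :
  subquotient_map (quot_class (trace S T) x) =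
  quot_class (trace S' T') (sub_module_map x).
Proof. exact: subquotient_funE. Qed.

End SubquotientMap.

(** * The action of [GL M] on flags *)

Section Flags.
Variables (A : pzRingType) (M : lmodType A).
Implicit Types (g u : GL M) (F : flag M).

Lemma act_homo g (S : submodule M) : {homo g : x / x \in S >-> x \in act g S}.
Proof. by move=> x; rewrite mem_act. Qed.

Lemma actV_homo g (S : submodule M) : {homo gl_inv g : x / x \in act g S >-> x \in S}.
Proof. by []. Qed.

Definition subquotient_act g (S T : submodule M) :=
  subquotient_map (f := gl_fun g) (@act_homo g S) (@act_homo g T).

Definition subquotient_actV g (S T : submodule M) :=
  subquotient_map (f := gl_inv g) (@actV_homo g S) (@actV_homo g T).

Lemma subquotient_actK g (S T : submodule M) :
  cancel (subquotient_act g S T) (subquotient_actV g S T).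
Proof.
elim/quot_ind=> x; rewrite [X in subquotient_actV _ _ _ X]subquotient_mapE.
rewrite [LHS]subquotient_mapE; congr quot_class.
by apply: val_inj; rewrite /= gl_funK.
Qed.

Lemma subquotient_actVK g (S T : submodule M) :
  cancel (subquotient_actV g S T) (subquotient_act g S T).
Proof.
elim/quot_ind=> x; rewrite [X in subquotient_act _ _ _ X]subquotient_mapE.
rewrite [LHS]subquotient_mapE; congr quot_class.
by apply: val_inj; rewrite /= gl_invK.
Qed.

(** The automorphism [g] induces isomorphisms of the successive subquotients, which carry over being
    nonzero and being finitely generated projective. *)
Lemma act_is_flag g s : is_flag s -> is_flag (act_chain g s).
Proof.
case=> [->|sF]; [by left|right => i; rewrite size_map => /sF[sub [x x0] proj]].
rewrite !stage_act; split=> [y||]; first by rewrite !actE; exact: sub.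
  exists (subquotient_act g _ _ x); apply: contra_neq x0 => gx0.
  by rewrite -(subquotient_actK g x) gx0 linear0.
exact: fg_projective_retract (@subquotient_actVK g _ _) proj.
Qed.

Lemma unipotent_E_group F : (unipotent F `<=` E_group M)%classic.
Proof. by move=> u Uu; apply: sub_generated; exists F. Qed.

(** Conjugation by [g] carries [unipotent F] into the unipotent group of the flag [g F], so it
    permutes the generators. *)
Lemma E_group_normal : is_normal (E_group M).
Proof.
apply: generated_normal => g u [F _ Uu].
exists (Flag (act_is_flag g (flagP F))) => //; exact: unipotentJ.
Qed.

(** * From the category to the quotient group *)

Local Notation nE := E_group_normal.

Definition rbs_coset F F' (x : rbs_hom F F') : quotient_group nE :=
  coset nE (sval (Defs.lift x)).

Lemma rbs_cosetE F F' (p : rbs_pre F F') :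
  rbs_coset (rbs_class p) = coset nE (sval p).
Proof.
have [u Uu ->] := lift_class (rbs_equiv F F') p.
by apply/cosetE; rewrite mulKg; exact: unipotent_E_group Uu.
Qed.

Definition rbs_coset_functor : functor (RBS M) (deloop (quotient_group nE)).
Proof.
refine (@Functor (RBS M) (deloop (quotient_group nE)) (fun=> tt)
  rbs_coset _ _) => [F|F F' F'' h g] /=; first by rewrite rbs_cosetE.
elim/rbs_ind: h => h; elim/rbs_ind: g => g.
by rewrite rbs_compE !rbs_cosetE [RHS]coset_mulE.
Defined.

Lemma GL_to_pi1E g :
  GL_to_pi1 M g = loc_class (@gmor (RBS M) _ _ (rbs_empty g)).
Proof. exact: (pi1_mapE (incl_empty M)). Qed.

(** Every morphism of [deloop] is invertible, so [rbs_coset_functor] extends to the localisation.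
    The resulting [psi] will bound the kernel from above. *)
Lemma GL_to_pi1_retraction :
  exists psi : pi1 (RBS M) (empty_flag M) -> quotient_group nE,
    forall g, psi (GL_to_pi1 M g) = coset nE g.
Proof.
have [H [[_ _ HE] _]] := loc_universal (F := rbs_coset_functor)
  (inv := fun _ _ x => (rbs_coset x)^-1)
  (fun _ _ x => mulVg (rbs_coset x)) (fun _ _ x => mulgV (rbs_coset x)).
exists (H (empty_flag M) (empty_flag M)) => g.
by rewrite GL_to_pi1E HE /= rbs_cosetE.
Qed.

(** * Paths to the empty flag, surjectivity and kernel *)

Lemma refines_nil (s : seq (submodule M)) : refines s (empty_flag M).
Proof. by []. Qed.

Definition to_empty F : @Defs.hom (RBS M) F (empty_flag M) :=
  rbs_class (exist _ 1 (refines_nil _)).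

Lemma to_empty_comp F F' (p : rbs_pre F F') :
  Defs.comp (to_empty F') (rbs_class p : @Defs.hom (RBS M) F F') =
  Defs.comp (rbs_empty (sval p) : @Defs.hom (RBS M) _ _) (to_empty F).
Proof.
rewrite [LHS]rbs_compE [RHS]rbs_compE; apply/rbs_classE; exists 1.
  by case: (unipotent_sub F).
by rewrite /= mul1g !mulg1.
Qed.

(** The representatives [u] and [1] differ by right multiplication by [u], which is divided out in
    morphisms with source [F]. *)
Lemma to_empty_unipotent F u : unipotent F u ->
  Defs.comp (rbs_empty u : @Defs.hom (RBS M) _ _) (to_empty F) = to_empty F.
Proof.
move=> Uu; rewrite [LHS]rbs_compE; apply/esym/rbs_classE; exists u => //.
by rewrite /= mul1g mulg1.
Qed.

Definition loc_to_empty F : @loc_hom (RBS M) F (empty_flag M) :=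
  loc_class (gmor (to_empty F)).

Lemma loc_to_empty_empty : loc_to_empty (empty_flag M) = loc_id _.
Proof.
apply/loc_classE; suff -> : to_empty (empty_flag M) = idc _ by exact: gw_mor1.
by apply/rbs_classE; exists 1; [case: (unipotent_sub (empty_flag M))|rewrite /= mulg1].
Qed.

(** By induction on the word: each letter slides past the paths to the empty flag by
    [to_empty_comp], and the automorphisms multiply or invert along with the word. *)
Lemma loc_to_empty_gword F F' (p : @gword (RBS M) F F') : exists g,
  loc_comp (loc_to_empty F') (loc_class p) =
  loc_comp (GL_to_pi1 M g) (loc_to_empty F).
Proof.
elim: p => {F F'} [F F' f|F|F F' F'' q [h qh] p [g pg]|F F' p [g pg]].
- elim/rbs_ind: f => f; exists (sval f); rewrite GL_to_pi1E !loc_compE.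
  apply/loc_classE; apply: gw_trans; first exact/gw_sym/gw_morM.
  by rewrite to_empty_comp; exact: gw_morM.
- exists 1; rewrite (morph_gmul1 (@GL_to_pi1M _ M)).
  by rewrite [LHS]loc_compr1 [RHS]loc_comp1.
- exists (h * g); rewrite -loc_compE loc_compA qh -loc_compA pg loc_compA.
  by rewrite (@GL_to_pi1M _ M).
exists g^-1; rewrite -loc_invE.
have gV : loc_comp (GL_to_pi1 M g^-1) (GL_to_pi1 M g) = loc_id _.
  rewrite -[loc_comp _ _]/(GL_to_pi1 M g^-1 * GL_to_pi1 M g) -(@GL_to_pi1M _ M).
  by rewrite mulVg (morph_gmul1 (@GL_to_pi1M _ M)).
(* Inserting [g^-1 * g] on the left exposes the right-hand side of [pg]; rewriting it back puts [p]
   next to its inverse. *)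
rewrite -[LHS]loc_comp1 -gV -loc_compA; congr loc_comp.
by rewrite loc_compA -pg -loc_compA loc_comprV loc_compr1.
Qed.

Lemma GL_to_pi1_surj (x : pi1 (RBS M) (empty_flag M)) :
  exists g, GL_to_pi1 M g = x.
Proof.
elim/loc_ind: x => p; have [g] := loc_to_empty_gword p.
(* For a loop at the empty flag, both paths to the empty flag are identities. *)
by rewrite loc_to_empty_empty loc_comp1 loc_compr1 => pg; exists g.
Qed.

(** The image of [u] fixes [loc_to_empty F] under composition, and this path can be cancelled in the
    groupoid. *)
Lemma GL_to_pi1_unipotent F u : unipotent F u -> GL_to_pi1 M u = 1.
Proof.
move=> Uu; have e : loc_comp (GL_to_pi1 M u) (loc_to_empty F) = loc_to_empty F.
  rewrite GL_to_pi1E loc_compE /loc_to_empty -[in RHS](to_empty_unipotent Uu).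
  exact/loc_classE/gw_sym/gw_morM.
rewrite -[LHS]loc_compr1 -(loc_comprV (loc_to_empty F)) loc_compA e.
exact: loc_comprV.
Qed.

Lemma GL_to_pi1_ker g : GL_to_pi1 M g = 1 <-> E_group M g.
Proof.
have pi1E := morph_gmul1 (@GL_to_pi1M _ M).
split=> [g1|Eg].
  have [psi psiE] := GL_to_pi1_retraction.
  (* Writing [g] as [1^-1 * g] turns membership into equality of the cosets of [1] and [g], which
     are the values of [psi] at equal loops. *)
  by rewrite -[g]mul1g -invg1; apply/(cosetE nE); rewrite -!psiE g1 pi1E.
(* The kernel is one of the subgroups whose intersection defines [E_group M]. *)
apply: (Eg (fun g => GL_to_pi1 M g = 1)); split.
  split=> [//|h k h1 k1|h h1]; first by rewrite (@GL_to_pi1M _ M) h1 k1 mulg1.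
  by rewrite -[LHS]mulg1 -{1}h1 -(@GL_to_pi1M _ M) mulVg pi1E.
by move=> u [F _]; exact: GL_to_pi1_unipotent.
Qed.

End Flags.

Unset Implicit Arguments.

Theorem theorem1p2 (A : pzRingType) (M : lmodType A)
    (fgpM : fg_projective M) (noethM : split_noetherian M) :
  [/\ forall x : pi1 (RBS M) (empty_flag M), exists g : GL M, GL_to_pi1 M g = x,
      forall g : GL M, GL_to_pi1 M g = 1 <-> E_group M g
    & exists (nE : is_normal (E_group M))
             (phi : {multiplicative quotient_group nE ->
                                    pi1 (RBS M) (empty_flag M)}),
        bijective phi /\ forall g : GL M, phi (coset nE g) = GL_to_pi1 M g].
Proof.
split; [exact: GL_to_pi1_surj|exact: GL_to_pi1_ker|exists (E_group_normal M)].
exact: first_isomorphism (@GL_to_pi1M _ M) (@GL_to_pi1_ker _ M)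
  (@GL_to_pi1_surj _ M).
Qed.
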